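(* Let $G$ be a finite graph (loopless, possibly with multiple edges), and let $\Delta$ and $\delta$ denote its maximum and minimum degree, respectively. Then $\check{s}(G)=2$ if and only if $\Delta>\delta$ and $G$ can be decomposed into at most two Class 1 regular subgraphs $H_0$ and $H_1$ (either of which may be absent from the decomposition) such that - $H_0$, if present, is spanning and $\delta$-regular; - $H_1$, if present, is $(\Delta-\delta)$-regular.
   Context: A $k$-edge-coloring of $G$ is a map $c\colon E(G)\to\{1,\dots,k\}$ such that any two distinct edges sharing an endpoint receive different colors. The palette of a vertex $v$ with respect to $c$ is $P_c(v)=\{c(e): e \text{ incident with } v\}$ (empty if $v$ is isolated). The palette index $\check{s}(G)$ is the minimum, over all edge-colorings $c$ of $G$ (with any number of colors), of the number of distinct palettes $P_c(v)$, $v\in V(G)$. A graph with maximum degree $\Delta$ is Class 1 if it admits a $\Delta$-edge-coloring; so an $r$-regular graph is Class 1 iff it admits an $r$-edge-coloring. A decomposition of $G$ is a family $\{H_i\}$ of subgraphs of $G$, each with nonempty edge set, whose edge sets are pairwise disjoint and have union $E(G)$. A subgraph is spanning if its vertex set is $V(G)$. *)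

(* Defs.v *)
From mathcomp Require Import all_boot.
From mathcomp Require Import boolp.

Set Implicit Arguments.
Unset Strict Implicit.
Unset Printing Implicit Defensive.

(* Edges form a type of their own, so parallel edges are allowed; each edge has
   exactly two distinct ends, so loops are not. *)
Record multigraph := Multigraph {
  vertex : finType;
  edge : finType;
  ends : edge -> {set vertex};
  card_ends : forall e, #|ends e| = 2 }.

Definition incident (G : multigraph) (v : vertex G) : {set edge G} :=
  [set e | v \in ends e].

Definition degree (G : multigraph) (v : vertex G) : nat := #|incident v|.

Definition max_degree (G : multigraph) : nat := \max_(v : vertex G) degree v.

(* The neutral element only matters when there is no vertex; it is at least
   every degree otherwise. *)
Definition min_degree (G : multigraph) : nat :=
  \big[minn/max_degree G]_(v : vertex G) degree v.

Definition regular (r : nat) (G : multigraph) : Prop :=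
  forall v : vertex G, degree v = r.

(* The colors 1, ..., k are represented by 'I_k; not all need be used. *)
Definition edge_coloring (G : multigraph) (k : nat) (c : {ffun edge G -> 'I_k})
    : Prop :=
  forall e f : edge G, e != f -> ends e :&: ends f != set0 -> c e != c f.

Definition palette (G : multigraph) (k : nat) (c : {ffun edge G -> 'I_k})
    (v : vertex G) : {set 'I_k} :=
  [set c e | e in incident v].

Definition palettes (G : multigraph) (k : nat) (c : {ffun edge G -> 'I_k})
    : {set {set 'I_k}} :=
  [set palette c v | v : vertex G].

Definition palette_count (G : multigraph) (n : nat) : Prop :=
  exists (k : nat) (c : {ffun edge G -> 'I_k}),
    edge_coloring c /\ #|palettes c| = n.

(* The minimum below ranges over infinitely many colorings, hence the classical
   [`[< _ >]]. *)
Lemma palette_count_ex (G : multigraph) : exists n, `[< palette_count G n >].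
Proof.
pose c : {ffun edge G -> 'I_#|edge G|} := [ffun e => enum_rank e].
exists #|palettes c|; apply/asboolP; exists #|edge G|, c; split=> // e f ef _.
by rewrite !ffunE (inj_eq enum_rank_inj).
Qed.

Definition palette_index (G : multigraph) : nat := ex_minn (palette_count_ex G).

Definition class1 (G : multigraph) : Prop :=
  exists c : {ffun edge G -> 'I_(max_degree G)}, edge_coloring c.

Record subgraph (G : multigraph) := Subgraph {
  sub_vertices : {set vertex G};
  sub_edges : {set edge G};
  sub_closed : forall e, e \in sub_edges -> ends e \subset sub_vertices }.

Section GraphOfSubgraph.
Variables (G : multigraph) (H : subgraph G).

Definition sub_ends (e : {e : edge G | e \in sub_edges H}) :
    {set {v : vertex G | v \in sub_vertices H}} :=
  [set v | val v \in ends (val e)].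

Lemma card_sub_ends e : #|sub_ends e| = 2.
Proof.
rewrite -(card_ends (val e)) -(card_imset _ val_inj).
congr #|pred_of_set _|; apply/setP => v; apply/imsetP/idP => [[u]|ve].
  by rewrite inE => ue ->.
have vH : v \in sub_vertices H by apply: (subsetP (sub_closed (valP e))).
by exists (exist _ v vH); rewrite ?inE.
Qed.

Definition graph_of_subgraph : multigraph := Multigraph card_sub_ends.

End GraphOfSubgraph.

Coercion graph_of_subgraph : subgraph >-> multigraph.

Definition spanning (G : multigraph) (H : subgraph G) : Prop :=
  sub_vertices H = [set: vertex G].

Definition decomposition (G : multigraph) (Hs : seq (subgraph G)) : Prop :=
  [/\ all (fun H => sub_edges H != set0) Hs,
      pairwise (fun H K => [disjoint sub_edges H & sub_edges K]) Hs
    & \bigcup_(H <- Hs) sub_edges H = [set: edge G]].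

(* Main.v *)
(** For the direct implication, let [P] and [Q] be the two palettes of an
    optimal coloring, with [#|Q| <= #|P|].  A color of [Q :\: P] occurs only
    between vertices with palette [Q], and a color of [P :\: Q] only between
    vertices with palette [P], so replacing the former injectively by the latter
    keeps the coloring proper and turns [Q] into a subset [Q'] of [P].  As one
    palette is impossible, [Q'] is proper, and [H0] and [H1] consist of the edges
    with a color in [Q'] and in [P :\: Q'].  Conversely, coloring [H0] and [H1]
    with disjoint sets of [delta] and [Delta - delta] colors leaves two palettes:
    all the colors, and the colors of [H0]. *)
Require Import Defs.
From mathcomp Require Import boolp.
From mathcomp Require Import all_boot.

Set Implicit Arguments.
Unset Strict Implicit.
Unset Printing Implicit Defensive.

(** * Extremal degrees *)

Lemma degree_le_max (G : multigraph) (v : vertex G) : degree v <= max_degree G.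
Proof. exact: (leq_bigmax v). Qed.

Lemma max_degree_eq (G : multigraph) (v : vertex G) :
  (forall u : vertex G, degree u <= degree v) -> max_degree G = degree v.
Proof.
by move=> le_v; apply/eqP; rewrite eqn_leq degree_le_max andbT; apply/bigmax_leqP.
Qed.

Lemma max_degree_regular (G : multigraph) r (v : vertex G) :
  regular r G -> max_degree G = r.
Proof. by move=> reg; rewrite (@max_degree_eq _ v) // => u; rewrite !reg. Qed.

Lemma min_degree_le (G : multigraph) (v : vertex G) : min_degree G <= degree v.
Proof.
(* The default [max_degree G] is not neutral for [minn] on all of [nat], so the fold is unfolded and
   handled by induction. *)
rewrite /min_degree unlock /=; elim: (index_enum _) (mem_index_enum v) => //= u s IHs.
rewrite inE => /predU1P[<-|/IHs]; first exact: geq_minl.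
by apply: leq_trans; apply: geq_minr.
Qed.

Lemma min_degree_eq (G : multigraph) (v : vertex G) :
  (forall u : vertex G, degree v <= degree u) -> min_degree G = degree v.
Proof.
move=> v_le; apply/eqP; rewrite eqn_leq min_degree_le /= /min_degree.
elim/big_ind: _ => [|m n vm vn|u _]; [exact: degree_le_max| |exact: v_le].
by rewrite leq_min vm.
Qed.

(** Strictness rules out both degenerate cases: an empty vertex set, where the maximum is 0, and a
    minimum equal to its default value. *)
Lemma extremal_degrees (G : multigraph) :
  min_degree G < max_degree G ->
  exists u v : vertex G, degree u = min_degree G /\ degree v = max_degree G.
Proof.
move=> lt_mM.
have [|v _ max_v] := @eq_bigmax_cond _ predT (@degree G).
  case: (posnP #|vertex G|) => // /card0_eq V0.
  suff: max_degree G <= 0 by rewrite leqNgt (leq_ltn_trans _ lt_mM).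
  by apply/bigmax_leqP => v; have := V0 v.
have : min_degree G = max_degree G \/ exists u : vertex G, degree u = min_degree G.
  apply: (big_ind (fun m => m = _ \/ exists u, degree u = m)) => [|m n|u _].
  - by left.
  - by rewrite /minn; case: ifP.
  - by right; exists u.
case=> [eq_mM|[u du]]; first by rewrite eq_mM ltnn in lt_mM.
by exists u, v.
Qed.

Lemma ends_exists (G : multigraph) (e : edge G) : exists v, v \in ends e.
Proof. by apply/card_gt0P; rewrite card_ends. Qed.

(** * Proper colorings and palette sizes *)

Section Coloring.
Variables (G : multigraph) (k : nat) (c : {ffun edge G -> 'I_k}).

Lemma edge_coloringP :
  edge_coloring c <-> forall v, {in incident v &, injective c}.
Proof.
split=> [col v e f|inj e f ne /set0Pn[v]].
  rewrite !inE => ve vf /eqP; apply: contraTeq => /col; apply.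
  by apply/set0Pn; exists v; rewrite inE ve.
by rewrite inE => /andP[ve vf]; apply: contraNneq ne => /(inj v) ->; rewrite ?inE.
Qed.

Lemma mem_palette v e : v \in ends e -> c e \in palette c v.
Proof. by move=> ve; apply: imset_f; rewrite inE. Qed.

Hypothesis col : edge_coloring c.

Lemma card_palette v : #|palette c v| = degree v.
Proof. by move/edge_coloringP: col => /(_ v)/card_in_imset. Qed.

Lemma card_incident_colors (A : {set 'I_k}) v :
  #|incident v :&: c @^-1: A| = #|palette c v :&: A|.
Proof.
rewrite -(card_in_imset (f := c)).
  congr #|pred_of_set _|; apply/setP => i; apply/imsetP/idP => [[e]|].
    rewrite !inE => /andP[ve cA] ->; rewrite cA andbT; exact: mem_palette.
  rewrite inE => /andP[/imsetP[e ve ->] cA].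
  by exists e => //; rewrite inE ve inE.
move=> e f; rewrite inE => /andP[ve _]; rewrite inE => /andP[vf _].
by move/edge_coloringP: col => /(_ v); apply.
Qed.

(** Palette sizes are degrees, so vertices of different degrees have different palettes. *)
Lemma card_palettes_gt1 : min_degree G < max_degree G -> 1 < #|palettes c|.
Proof.
move=> lt_mM; have [u [v [du dv]]] := extremal_degrees lt_mM.
apply/card_gt1P; exists (palette c u), (palette c v); split; try exact: imset_f.
apply: contraTneq lt_mM => euv.
by rewrite -du -dv -!card_palette euv ltnn.
Qed.

End Coloring.

Lemma palette_index_le (G : multigraph) n :
  palette_count G n -> palette_index G <= n.
Proof.
by move=> Gn; rewrite /palette_index; case: ex_minnP => m _; apply; apply/asboolP.
Qed.

Lemma palette_indexP (G : multigraph) : palette_count G (palette_index G).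
Proof. by rewrite /palette_index; case: ex_minnP => m /asboolP. Qed.

Lemma palette_count2_index (G : multigraph) :
  min_degree G < max_degree G -> palette_count G 2 -> palette_index G = 2.
Proof.
move=> lt_mM G2; apply/eqP; rewrite eqn_leq palette_index_le //=.
have [k [c [col <-]]] := palette_indexP G.
exact: card_palettes_gt1.
Qed.

(** * Degrees and colorings of a subgraph, seen in the ambient graph *)

Section SubgraphDegrees.
Variables (G : multigraph) (H : subgraph G).

Lemma degree_subgraph (v : vertex H) :
  degree v = #|incident (val v) :&: sub_edges H|.
Proof.
rewrite /degree -(card_imset _ val_inj).
congr #|pred_of_set _|; apply/setP => e; apply/imsetP/idP => [[f]|].
  by rewrite !inE => vf ->; rewrite vf (valP f).
rewrite !inE => /andP[ve eH].
by exists (exist _ e eH) => //; rewrite !inE.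
Qed.

Lemma incident_subgraph_eq0 v :
  v \notin sub_vertices H -> incident v :&: sub_edges H = set0.
Proof.
move=> vH; apply/setP => e; rewrite !inE; apply/negP => /andP[ve eH].
by rewrite (subsetP (sub_closed eH)) in vH.
Qed.

(** Total functions to [nat] let the colorings of two subgraphs, whose edge types differ, be merged
    later. An edge of [H] supplies a vertex that pins the maximum degree to [r], and a default for
    [insubd]. *)
Lemma class1_colors r :
  class1 H -> regular r H -> sub_edges H != set0 ->
  exists f : edge G -> nat,
    {in sub_edges H, forall e, f e < r} /\
    forall v, {in incident v :&: sub_edges H &, injective f}.
Proof.
move=> [c col] reg /set0Pn[e0 e0H].
have [v0 v0e] := ends_exists e0.
have v0H : v0 \in sub_vertices H by apply: (subsetP (sub_closed e0H)).
have max_r : max_degree H = r := max_degree_regular (exist _ v0 v0H : vertex H) reg.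
pose e0' : edge H := exist _ e0 e0H.
exists (fun e => c (insubd e0' e)); split=> [e eH|v e f]; first by rewrite -max_r.
move=> /setIP[ve eH] /setIP[vf fH] /val_inj ecf; rewrite inE in ve; rewrite inE in vf.
have vH : v \in sub_vertices H by apply: (subsetP (sub_closed eH)).
have /edge_coloringP/(_ (exist _ v vH)) inj := col.
have /(congr1 val) : insubd e0' e = insubd e0' f.
  by apply: inj ecf; rewrite !inE /= val_insubd ?eH ?fH.
by rewrite !val_insubd eH fH.
Qed.

End SubgraphDegrees.

(** * Subgraphs cut out by a set of colors *)

Section ColorSubgraph.
Variables (G : multigraph) (k : nat) (c : {ffun edge G -> 'I_k}).
Variables (A : {set 'I_k}) (V : {set vertex G}).
Hypothesis col : edge_coloring c.
Hypothesis V_closed : forall e, e \in c @^-1: A -> ends e \subset V.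
Hypothesis V_full : forall v, v \in V -> A \subset palette c v.

(** Both members of the decomposition arise this way: [H0] from the smaller palette on all vertices,
    [H1] from the remaining colors on the vertices with the larger palette. *)
Definition color_subgraph : subgraph G := Subgraph V_closed.

Lemma color_subgraph_regular : regular #|A| color_subgraph.
Proof.
move=> v; rewrite degree_subgraph /= card_incident_colors //.
by congr #|pred_of_set _|; apply/setIidPr/V_full/(valP v).
Qed.

Lemma color_subgraph_class1 v : v \in V -> class1 color_subgraph.
Proof.
move=> vV; rewrite /class1.
rewrite (max_degree_regular (exist _ v vV : vertex color_subgraph)
           color_subgraph_regular).
have cA (e : edge color_subgraph) : c (val e) \in A by have := valP e; rewrite inE.
(* Colors are renumbered by their rank in [A]. The proof [cA e] only witnesses that [A] is
   inhabited, so it may vary with [e]. *)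
exists [ffun e => enum_rank_in (cA e) (c (val e))].
apply/edge_coloringP => u e f; rewrite !inE !ffunE => ue uf.
move=> /(congr1 enum_val); rewrite !enum_rankK_in // => cef; apply: val_inj.
by have /edge_coloringP/(_ (val u)) inj := col; apply: inj; rewrite ?inE.
Qed.

End ColorSubgraph.

(** * Direct implication: nesting the palettes *)

Lemma nest_palettes (G : multigraph) k (c : {ffun edge G -> 'I_k})
    (P Q : {set 'I_k}) :
  edge_coloring c -> (forall v, palette c v = P \/ palette c v = Q) ->
  #|Q| <= #|P| ->
  exists (c' : {ffun edge G -> 'I_k}) (Q' : {set 'I_k}),
    [/\ edge_coloring c', Q' \subset P, #|Q'| = #|Q|
      & forall v, palette c' v = P \/ palette c' v = Q'].
Proof.
move=> /edge_coloringP inj cPQ leQP.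
have leD : #|Q :\: P| <= #|P :\: Q|.
  by rewrite -(leq_add2l #|P :&: Q|) {1}setIC !cardsID.
(* [g] fixes [P] and matches [Q :\: P] with an initial part of [P :\: Q] by position; on [Q] the
   default of [nth] is never reached. *)
pose g i := if i \in P then i else nth i (enum (P :\: Q)) (index i (enum (Q :\: P))).
have idxD i : i \in Q -> i \notin P ->
    index i (enum (Q :\: P)) < size (enum (P :\: Q)).
  move=> iQ iP; rewrite -cardE; apply: leq_trans leD.
  by rewrite cardE index_mem mem_enum inE iP.
have gD i : i \in Q -> i \notin P -> g i \in P :\: Q.
  by move=> iQ iP; rewrite /g (negPf iP) -mem_enum mem_nth // idxD.
have gP i : i \in P -> g i = i by rewrite /g => ->.
have g_inj : {in Q &, injective g}.
  move=> i j iQ jQ; case: (boolP (i \in P)) => iP; case: (boolP (j \in P)) => jP.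
  - by rewrite !gP.
  - by rewrite (gP _ iP) => eij; have := gD j jQ jP; rewrite -eij inE iQ.
  - by rewrite (gP _ jP) => eij; have := gD i iQ iP; rewrite eij inE jQ.
  rewrite /g (negPf iP) (negPf jP) (set_nth_default j) ?idxD // => /eqP.
  rewrite nth_uniq ?idxD ?enum_uniq // => /eqP/(index_inj i); apply.
    by rewrite mem_enum inE iP.
  by rewrite mem_enum inE jP.
(* [g] need not be injective on all colors: properness only compares colors within one palette. *)
have g_pal v : {in palette c v &, injective g}.
  case: (cPQ v) => -> // i j iP jP; by rewrite !gP.
pose c' : {ffun edge G -> 'I_k} := [ffun e => g (c e)].
have pal' v : palette c' v = g @: palette c v.
  rewrite /palette -imset_comp; apply: eq_imset => e; by rewrite ffunE.
exists c', (g @: Q); split.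
- apply/edge_coloringP => v e f ve vf; rewrite !ffunE => /(g_pal v) gef.
  by apply: (inj v) => //; apply: gef; apply: imset_f.
- apply/subsetP => _ /imsetP[i iQ ->].
  case: (boolP (i \in P)) => iP; first by rewrite gP.
  by have := gD i iQ iP; rewrite inE => /andP[].
- exact: card_in_imset.
move=> v; rewrite pal'; case: (cPQ v) => ->; last by right.
left; rewrite -[RHS]imset_id; exact: eq_in_imset.
Qed.

Lemma two_nested_palettes (G : multigraph) :
  palette_index G = 2 ->
  exists k (c : {ffun edge G -> 'I_k}) (P Q : {set 'I_k}),
    [/\ edge_coloring c, Q \proper P,
        forall v, palette c v = P \/ palette c v = Q,
        min_degree G = #|Q| & max_degree G = #|P|].
Proof.
move=> G2; have := palette_indexP G; rewrite G2 => -[k [c [col /eqP/cards2P]]].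
case=> [P [Q [neqPQ palE]]].
wlog leQP : P Q neqPQ palE / #|Q| <= #|P|.
  move=> IH; case: (leqP #|Q| #|P|) => [|/ltnW]; first exact: IH.
  by apply: IH; rewrite 1?eq_sym // palE setUC.
have cPQ v : palette c v = P \/ palette c v = Q.
  by apply/set2P; rewrite -palE; apply: imset_f.
have /imsetP[p _ Pp] : P \in palettes c by rewrite palE set21.
have /imsetP[q _ Qq] : Q \in palettes c by rewrite palE set22.
have [c' [Q' [col' subQ' cardQ' cPQ']]] := nest_palettes col cPQ leQP.
have deg (v : vertex G) : degree v = #|P| \/ degree v = #|Q|.
  by rewrite -(card_palette col); case: (cPQ v) => ->; [left|right].
have dp : degree p = #|P| by rewrite -(card_palette col) -Pp.
have dq : degree q = #|Q| by rewrite -(card_palette col) -Qq.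
exists k, c', P, Q'; split=> //.
(* If [Q'] were [P], the new coloring would have a single palette, against the minimality of 2. *)
- rewrite properEneq subQ' andbT; apply/eqP => eqQP.
  suff /palette_index_le : palette_count G 1 by rewrite G2.
  exists k, c'; split=> //; apply/eqP/cards1P; exists P.
  apply/setP => A; rewrite inE; apply/imsetP/eqP => [[v _ ->]|->].
    by case: (cPQ' v); rewrite ?eqQP.
  by exists p => //; case: (cPQ' p); rewrite ?eqQP.
- rewrite cardQ' -dq; apply: min_degree_eq => u.
  by rewrite dq; case: (deg u) => ->.
rewrite -dp; apply: max_degree_eq => u.
by rewrite dp; case: (deg u) => ->.
Qed.

(** * Converse: merging two colorings *)

Lemma palette_count2_of_split (G : multigraph) (E0 : {set edge G})
    (f0 f1 : edge G -> nat) :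
  let d := min_degree G in let D := max_degree G in
  d < D ->
  (forall v : vertex G, #|incident v :&: E0| = d) ->
  (forall v : vertex G, degree v < D -> incident v \subset E0) ->
  {in E0, forall e, f0 e < d} -> {in ~: E0, forall e, f1 e < D - d} ->
  (forall v, {in incident v :&: E0 &, injective f0}) ->
  (forall v, {in incident v :\: E0 &, injective f1}) ->
  palette_count G 2.
Proof.
move=> d D lt_dD degE0 lowE0 f0_lt f1_lt f0_inj f1_inj.
(* Shifting [f1] by [d] makes the two color ranges disjoint. *)
pose h e := if e \in E0 then f0 e else d + f1 e.
have h_lt e : h e < D.
  rewrite /h; case: ifPn => eE; first exact: ltn_trans (f0_lt e eE) lt_dD.
  by rewrite -ltn_subRL f1_lt // inE.
pose c : {ffun edge G -> 'I_D} := [ffun e => Ordinal (h_lt e)].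
have col : edge_coloring c.
  apply/edge_coloringP => v e f ve vf; rewrite !ffunE => /(congr1 val) /=.
  rewrite /h; case: ifPn => eE; case: ifPn => fE.
  - by apply: (f0_inj v); rewrite inE ?ve ?vf.
  - by move=> ef; have := f0_lt e eE; rewrite ef ltnNge leq_addr.
  - by move=> ef; have := f0_lt f fE; rewrite -ef ltnNge leq_addr.
  - by move/addnI; apply: (f1_inj v); rewrite inE ?eE ?fE ?ve ?vf.
exists D, c; split=> //; apply/eqP; rewrite eqn_leq card_palettes_gt1 // andbT.
pose low := [set i : 'I_D | i < d].
suff /subset_leq_card : palettes c \subset [set setT; low].
  by move=> /leq_trans -> //; rewrite cards2; case: (_ != _).
have card_low : #|low| = d.
  have -> : low = [set widen_ord (ltnW lt_dD) i | i : 'I_d].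
    apply/setP => i; rewrite inE; apply/idP/imsetP => [lt_id|[j _ ->]] /=.
      by exists (Ordinal lt_id) => //; apply: val_inj.
    exact: ltn_ord.
  by rewrite card_imset ?card_ord // => i j /(congr1 val) /= /val_inj.
apply/subsetP => _ /imsetP[v _ ->].
(* A vertex of degree [D] sees all [D] colors; any other has only its [d] edges in [E0], which use
   up the colors below [d]. *)
have := degree_le_max v; rewrite leq_eqVlt => /predU1P[dv|/lowE0 vE0].
  apply/set2P; left; apply/eqP.
  by rewrite eqEcard subsetT cardsT card_ord (card_palette col) dv leqnn.
apply/set2P; right; apply/eqP; rewrite eqEcard card_low (card_palette col).
rewrite -(degE0 v) (setIidPl vE0) leqnn andbT.
apply/subsetP => _ /imsetP[e ve ->]; have eE0 := subsetP vE0 e ve.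
by rewrite !ffunE inE /= /h eE0 f0_lt.
Qed.

(** * Members that may be absent *)

Definition opt_edges (G : multigraph) (o : option (subgraph G)) : {set edge G} :=
  oapp (@sub_edges G) set0 o.

(** Disjointness and covering together amount to complementation, which stays meaningful when an
    absent member counts as an empty edge set. *)
Lemma opt_decompositionP (G : multigraph) (o0 o1 : option (subgraph G)) :
  decomposition (pmap id [:: o0; o1]) <->
  opt_edges o1 = ~: opt_edges o0 /\
  (forall H, o0 = Some H \/ o1 = Some H -> sub_edges H != set0).
Proof.
have splitP (A B : {set edge G}) :
    B = ~: A <-> [disjoint A & B] /\ A :|: B = setT.
  split=> [->|[dAB /setP UAB]].
    by rewrite setUCr -setI_eq0 setICr eqxx.
  apply/setP => e; rewrite inE; have := UAB e; rewrite !inE.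
  by case: (boolP (e \in A)) => //= eA _; rewrite (disjointFr dAB eA).
rewrite splitP /opt_edges /decomposition.
case: o0 o1 => [H0|] [H1|] /=; rewrite ?big_cons big_nil ?setU0 ?set0U ?andbT.
- split=> [[/andP[n0 n1] d01 U01]|[[d01 U01] ne]].
    by split=> // H [] [<-].
  by split=> //; rewrite !ne; auto.
- split=> [[n0 _ U0]|[[_ U0] ne]].
    by split=> [|H [] // [<-] //]; rewrite -setI_eq0 setI0 eqxx.
  by split=> //; apply: ne; left.
- split=> [[n1 _ U1]|[[_ U1] ne]].
    by split=> [|H [] // [<-] //]; rewrite -setI_eq0 set0I eqxx.
  by split=> //; apply: ne; right.
- split=> [[_ _ U]|[[_ U] _]]; last by [].
  by split=> [|H []]; rewrite // -setI_eq0 setI0 eqxx.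
Qed.

Lemma opt_colors (G : multigraph) (o : option (subgraph G)) r :
  (forall H : subgraph G, o = Some H ->
     [/\ class1 H, regular r H & sub_edges H != set0]) ->
  exists f : edge G -> nat,
    [/\ {in opt_edges o, forall e, f e < r},
        forall v, {in incident v :&: opt_edges o &, injective f}
      & forall v, #|incident v :&: opt_edges o| = 0 \/
                  #|incident v :&: opt_edges o| = r].
Proof.
case: o => [H /(_ H erefl)[cl reg ne]|_] /=.
  have [f [f_lt f_inj]] := class1_colors cl reg ne.
  exists f; split=> // v; case: (boolP (v \in sub_vertices H)) => vH.
    by right; rewrite -(reg (exist _ v vH)) degree_subgraph.
  by left; rewrite incident_subgraph_eq0 ?cards0.
exists (fun=> 0); split=> [e|v e f|v]; rewrite ?inE ?andbF //.
by left; rewrite setI0 cards0.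
Qed.

(* [None] stands for an absent member; [pmap id] keeps the members present. *)
Theorem theorem6 (G : multigraph) :
  palette_index G = 2 <->
  min_degree G < max_degree G /\
  exists H0 H1 : option (subgraph G),
    [/\ decomposition (pmap id [:: H0; H1]),
        (forall H : subgraph G, H0 = Some H ->
           [/\ class1 H, spanning H & regular (min_degree G) H])
      & (forall H : subgraph G, H1 = Some H ->
           class1 H /\ regular (max_degree G - min_degree G) H)].
Proof.
split=> [/two_nested_palettes[k [c [P [Q [col QP cPQ mQ MP]]]]]|].
  have lt_mM : min_degree G < max_degree G by rewrite mQ MP proper_card.
  split=> //; have [q [p [dq dp]]] := extremal_degrees lt_mM.
  have [sQP [i0 i0P i0Q]] := properP QP.
  (* A palette [Q] at [p] would give the maximum degree the size of [Q], which is the minimum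
     degree. *)
  have Pp : palette c p = P.
    case: (cPQ p) => // cpQ; move: dp; rewrite -(card_palette col) cpQ -mQ => eq_mM.
    by rewrite eq_mM ltnn in lt_mM.
  have palP e v : v \in ends e -> c e \in P.
    by move/mem_palette => /(_ _ c); case: (cPQ v) => -> // /(subsetP sQP).
  have cP e : c e \in P by have [v /palP] := ends_exists e.
  have V0_closed e : e \in c @^-1: Q -> ends e \subset setT by rewrite subsetT.
  have V0_full v : v \in setT -> Q \subset palette c v by case: (cPQ v) => ->.
  pose V1 := [set v | palette c v == P].
  (* Each end of such an edge sees a color outside [Q], so its palette is [P]. *)
  have V1_closed e : e \in c @^-1: (P :\: Q) -> ends e \subset V1.
    rewrite !inE => /andP[eQ _]; apply/subsetP => v ve; rewrite inE.
    by case: (cPQ v) eQ => [->//|<-]; rewrite mem_palette.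
  have V1_full v : v \in V1 -> P :\: Q \subset palette c v.
    by rewrite inE => /eqP ->; apply: subsetDl.
  have pV1 : p \in V1 by rewrite inE Pp.
  pose K0 := color_subgraph V0_closed; pose K1 := color_subgraph V1_closed.
  (* When the minimum degree is 0, [K0] has no edge and must be left out; [K1] always has one since
     [Q] is proper in [P]. *)
  exists (if Q == set0 then None else Some K0), (Some K1); split.
  - apply/opt_decompositionP; split.
      apply/setP => e; rewrite !inE cP andbT; case: eqP => [->|_]; by rewrite !inE.
    (* Every color of [P] occurs on an edge at [p]. *)
    have neK (A : {set 'I_k}) i : i \in A -> A \subset P -> c @^-1: A != set0.
      move=> iA /subsetP/(_ i iA); rewrite -Pp => /imsetP[e _ cei].
      by apply/set0Pn; exists e; rewrite inE -cei.
    move=> H [|[<-]]; last by apply: (neK _ i0); rewrite ?subsetDl // inE i0P i0Q.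
    by case: eqP => // /eqP/set0Pn[i iQ] [<-]; apply: neK iQ sQP.
  - move=> H; case: eqP => // _ [<-]; rewrite mQ; split=> //.
      exact: (color_subgraph_class1 col V0_closed V0_full (in_setT p)).
    exact: color_subgraph_regular.
  - move=> H [<-]; rewrite MP mQ -{1}(setIidPr sQP) -cardsD; split.
      exact: (color_subgraph_class1 col V1_closed V1_full pV1).
    exact: color_subgraph_regular.
move=> [lt_mM [o0 [o1 [/opt_decompositionP[E1E ne] H0P H1P]]]].
have [|f0 [f0_lt f0_inj degE0]] := @opt_colors G o0 (min_degree G).
  by move=> H o0H; have [cl _ reg] := H0P H o0H; split=> //; apply: ne; left.
have [|f1 [f1_lt f1_inj degE1]] := @opt_colors G o1 (max_degree G - min_degree G).
  by move=> H o1H; have [cl reg] := H1P H o1H; split=> //; apply: ne; right.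
have degD v : degree v = #|incident v :&: opt_edges o0| + #|incident v :&: opt_edges o1|.
  by rewrite E1E -setDE cardsID.
have {}degE0 v : #|incident v :&: opt_edges o0| = min_degree G.
  case: o0 H0P {E1E ne f0_lt f0_inj} degE0 degD => [H|] H0P degE0 degD /=.
    have [_ spanH reg] := H0P H erefl.
    have vH : v \in sub_vertices H by rewrite spanH inE.
    by rewrite -(reg (exist _ v vH)) degree_subgraph.
  (* Without [H0], all edges at a vertex of maximum degree lie in [H1], so that degree is 0 or the
     difference of the extremal degrees. The former is excluded, and the latter forces minimum
     degree 0. *)
  have [_ [p [_ dp]]] := extremal_degrees lt_mM.
  have := degD p; rewrite /= setI0 cards0 add0n dp.
  rewrite setI0 cards0; case: (degE1 p) => -> eqM.
    by rewrite eqM in lt_mM.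
  by rewrite -(subKn (ltnW lt_mM)) -eqM subnn.
apply: palette_count2_index => //.
apply: (@palette_count2_of_split G (opt_edges o0) f0 f1) => //; rewrite -?E1E //.
  (* A vertex on an edge of [H1] has maximum degree, so the vertices of smaller degree meet only
     edges of [H0]. *)
  move=> v; rewrite degD degE0; case: (degE1 v) => [/eqP|->]; last first.
    by rewrite subnKC ?ltnn // ltnW.
  by rewrite E1E -setDE cards_eq0 setD_eq0.
by move=> v; rewrite setDE -E1E.
Qed.
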